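(* Let $c$ be an irrational number for which there exist integers $p_n$ and $q_n\to\infty$ with $0<c-\frac{p_n}{q_n}$ and $q_n^2\left(c-\frac{p_n}{q_n}\right)\to0$. Let $T_t(x,y)=(\{x+t\},\{y+ct\})$ be the winding (linear flow) of the torus $M=[0,1)^2$ along the vector $(1,c)$, with Lebesgue measure, and let $\varphi:(0,\infty)\to(0,\infty)$ satisfy $\varphi(t)\to0$ as $t\to+\infty$. Then there exists a continuous function $f$ on the torus with $\int_M f=0$ such that for almost every $(x,y)\in M$ $$\limsup_{t\to+\infty}\frac{1}{\varphi(t)}|A(f,t,(x,y))|=+\infty.$$
   Context: $\{s\}$ denotes the fractional part of $s$. Birkhoff average: $A(f,t,z)=\frac1t\int_0^t f(T_sz)\,ds$. *)

(* Defs.v *)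
From HB Require Import structures.
From mathcomp Require Import all_boot all_order all_algebra.
From mathcomp Require Import all_classical all_reals all_analysis.
Set Implicit Arguments. Unset Strict Implicit. Unset Printing Implicit Defensive.
Import Order.TTheory GRing.Theory Num.Theory.
Import numFieldNormedType.Exports.
Local Open Scope classical_set_scope.
Local Open Scope ring_scope.

Definition frac {R : realType} (s : R) : R := s - (Num.floor s)%:~R.

Definition torus {R : realType} : set (R * R) := `[0, 1[%classic `*` `[0, 1[%classic.

Definition winding {R : realType} (c t : R) (z : R * R) : R * R :=
  (frac (z.1 + t), frac (z.2 + c * t)).

Definition birkhoff {R : realType} (c : R) (f : R * R -> R) (t : R) (z : R * R) : R :=
  t^-1 * (\int[lebesgue_measure]_(s in `[0, t]%classic) f (winding c s z)).

Definition torus_continuous {R : realType} (f : R * R -> R) : Prop :=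
  continuous f /\
  (forall x y : R, f (x + 1, y) = f (x, y)) /\
  (forall x y : R, f (x, y + 1) = f (x, y)).

Definition leb2 {R : realType} := ((@lebesgue_measure R) \x (@lebesgue_measure R))%E.

(* Main.v *)
Require Import Defs.
From HB Require Import structures.
From mathcomp Require Import all_boot all_order all_algebra.
From mathcomp Require Import all_classical all_reals all_analysis.
From mathcomp Require Import measurable_realfun ring lra.
Import Order.TTheory GRing.Theory Num.Theory.
Import numFieldNormedType.Exports.
Local Open Scope classical_set_scope.
Local Open Scope ring_scope.

(* Take f(x, y) = sum_k d^k cos(2 pi (q_k y - p_k x)) with d = 1/32, along a
   subsequence for which the frequencies w_k = q_k c - p_k > 0 tend to 0 very fast.
   Along an orbit the k-th term is d^k cos(theta + 2 pi w_k s). At a time t between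
   1 / (4 w_n) and 1 / (2 w_n) the terms k < n have averaged out, because w_n is tiny
   compared to w_k; the terms k > n are bounded by a geometric tail; and the n-th term
   contributes at least d^n / 8 for one of t = 1 / (4 w_n), 1 / (2 w_n), because sine
   and cosine do not vanish together. Hence |A(f, t, z)| >= d^n / 32 for some such t,
   for every point z, and w_n can be chosen so small that phi(t) is negligible compared
   to d^n for all t >= 1 / (4 w_n). *)

(** * Cosine series with geometric weights: tails, continuity, integrals of affine phases *)

Definition cos_term {R : realType} (d : R) (theta : nat -> R) : R ^nat :=
  fun k => d ^+ k * cos (theta k).

Definition cos_series {R : realType} (d : R) (theta : nat -> R) : R :=
  limn (series (cos_term d theta)).

Section CosSeries.
Variables (R : realType) (d : R).
Hypothesis d01 : 0 < d < 1.

Lemma cvg_cos_series (theta : nat -> R) :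
  series (cos_term d theta) @ \oo --> cos_series d theta.
Proof.
have /andP[d0 d1] := d01.
apply: normed_cvg; apply: (@series_le_cvg _ _ (geometric 1 d)) => [n|n|n|] /=.
- exact: normr_ge0.
- by rewrite mul1r exprn_ge0 ?ltW.
- rewrite normrM mul1r ger0_norm ?exprn_ge0 ?(ltW d0)//.
  by rewrite ler_piMr ?exprn_ge0 ?(ltW d0) ?cos_max.
- by apply: is_cvg_geometric_series; rewrite gtr0_norm.
Qed.

(** Differences of partial sums are dominated by a geometric sum, and the bound survives the limit.
    Being independent of [theta], it acts as a uniform estimate in what follows. *)
Lemma cos_series_tail (theta : nat -> R) n :
  `|cos_series d theta - \sum_(k < n) d ^+ k * cos (theta k)| <= d ^+ n / (1 - d).
Proof.
have /andP[d0 d1] := d01.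
rewrite -[X in _ - X](big_mkord xpredT (cos_term d theta)).
rewrite -[X in _ - X]/(series (cos_term d theta) n).
have h : (fun m => `|series (cos_term d theta) m - series (cos_term d theta) n|)
    @ \oo --> `|cos_series d theta - series (cos_term d theta) n|.
  by apply: cvg_norm; apply: cvgB; [exact: cvg_cos_series|exact: cvg_cst].
rewrite -(cvg_lim _ h)//; apply: limr_le; first by apply/cvg_ex; eexists; exact: h.
near=> m; have nm : (n <= m)%N by near: m; exact: nbhs_infty_ge.
rewrite /series/= (big_cat_nat _ (n := n))//= addrAC subrr add0r.
apply: le_trans (ler_norm_sum _ _ _) _.
apply: (@le_trans _ _ (\sum_(n <= k < m) d ^+ k)).
  apply: ler_sum => k _; rewrite normrM ger0_norm ?exprn_ge0 ?(ltW d0)//.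
  by rewrite ler_piMr ?exprn_ge0 ?(ltW d0) ?cos_max.
rewrite -(subnKC nm) geometric_partial_tail geometric_seriesE ?lt_eqF//=.
rewrite ler_wpM2r ?invr_ge0 ?subr_ge0 ?(ltW d1)//.
by rewrite ler_piMr ?exprn_ge0 ?(ltW d0)// gerBl exprn_ge0 ?ltW.
Unshelve. all: by end_near. Qed.

Lemma cos_series_bound (theta : nat -> R) : `|cos_series d theta| <= (1 - d)^-1.
Proof. by have := cos_series_tail theta 0; rewrite big_ord0 subr0 expr0 mul1r. Qed.

Lemma cos_series_tail_cvg0 : (fun n => d ^+ n / (1 - d)) @ \oo --> (0 : R).
Proof.
have /andP[d0 d1] := d01.
rewrite -[X in _ --> X](mul0r (1 - d)^-1); apply: cvgM; last exact: cvg_cst.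
by apply: cvg_expr; rewrite gtr0_norm.
Qed.

Lemma continuous_cos_series (T : topologicalType) (theta : nat -> T -> R) :
  (forall k, continuous (theta k)) ->
  continuous (fun x => cos_series d (theta^~ x)).
Proof.
move=> ctheta.
pose S n x := \sum_(k < n) d ^+ k * cos (theta k x).
apply: (@uniform_limit_continuous T R (S @ \oo)).
- suff: \forall n \near \oo, continuous (S n) by [].
  apply: nearW => n; apply: (@continuous_big R _ +%R) => [|k _ x]; first exact: add_continuous.
  apply: cvgM; first exact: cvg_cst.
  by apply: (@continuous_comp _ _ _ (theta k)); [exact: ctheta|exact: continuous_cos].
- move=> Q /uniform_nbhs[A [[e /= e0 eA] AQ]].
  have /cvgrPdist_lt /(_ _ e0) := cos_series_tail_cvg0; apply: filterS => n /=.
  rewrite sub0r normrN => he; apply: AQ => x _; apply: eA; rewrite /ball_ /=.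
  apply: le_lt_trans (cos_series_tail (theta^~ x) n) _.
  exact: le_lt_trans (ler_norm _) he.
Unshelve. all: by end_near. Qed.

Lemma Rintegral_cos_affine (A B t : R) : B != 0 -> 0 < t ->
  \int[lebesgue_measure]_(s in `[0, t]) cos (A + B * s) =
  (sin (A + B * t) - sin A) / B.
Proof.
move=> B0 t0.
pose F s := sin (A + B * s) / B.
have dF (s : R) : is_derive s (1 : R) F (cos (A + B * s)).
  have daff : is_derive s (1 : R) (cst A + B \*: id) B.
    by apply: is_derive_eq; rewrite /= add0r [LHS]mulr1.
  have dsin := @is_derive1_comp _ sin (cst A + B \*: id) s _ _ (is_derive_sin _) daff.
  have -> : F = B^-1 \*: (sin \o (cst A + B \*: id)).
    by apply/funext => u; rewrite /F mulrC.
  by apply: is_derive_eq; rewrite /= [LHS]mulrC mulfK.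
rewrite /Rintegral (@continuous_FTC2 _ _ F)//.
- by rewrite /F mulr0 addr0 /= mulrBl.
- apply: continuous_subspaceT => s.
  apply: continuous_comp; last exact: continuous_cos.
  by apply: cvgD; [exact: cvg_cst|apply: cvgM; [exact: cvg_cst|exact: cvg_id]].
- have cF s : {for s, continuous F} by apply/differentiable_continuous/derivable1_diffP.
  split.
  + by move=> s _; case: (dF s).
  + by apply: cvg_at_right_filter; exact: cF.
  + by apply: cvg_at_left_filter; exact: cF.
- by move=> s _; rewrite derive1E; apply: derive_val.
Qed.

Local Notation mu := (@lebesgue_measure R).

(** Only a partial sum is integrated termwise; the uniform tail bound times the length [t] controls
    the rest, so no infinite sum is exchanged with the integral. *)
Lemma Rintegral_cos_series (A B : nat -> R) n (t : R) :
  (forall k, B k != 0) -> 0 < t ->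
  `|\int[lebesgue_measure]_(s in `[0, t]) cos_series d (fun k => A k + B k * s)
     - \sum_(k < n) d ^+ k * ((sin (A k + B k * t) - sin (A k)) / B k)|
  <= t * (d ^+ n / (1 - d)).
Proof.
move=> B0 t0.
have cint (g : R -> R) : continuous g -> mu.-integrable `[0, t] (EFin \o g).
  move=> cg; apply: continuous_compact_integrable; first exact: segment_compact.
  exact: continuous_subspaceT.
have caff k : continuous (fun s : R => A k + B k * s).
  by move=> s; apply: cvgD; [exact: cvg_cst|apply: cvgM; [exact: cvg_cst|exact: cvg_id]].
have ccos k : continuous (fun s : R => cos (A k + B k * s)).
  by move=> s; apply: continuous_comp; [exact: caff|exact: continuous_cos].
pose P m s := \sum_(k < m) d ^+ k * cos (A k + B k * s).
have cP m : continuous (P m).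
  apply: (@continuous_big R _ +%R) => [|k _ s]; first exact: add_continuous.
  by apply: cvgM; [exact: cvg_cst|exact: ccos].
have cS : continuous (fun s : R => cos_series d (fun k => A k + B k * s)).
  exact: (@continuous_cos_series R (fun k s => A k + B k * s)).
have -> : \sum_(k < n) d ^+ k * ((sin (A k + B k * t) - sin (A k)) / B k) =
    \int[mu]_(s in `[0, t]) P n s.
  elim: n => [|n IH].
    by rewrite /P big_ord0; under eq_Rintegral do rewrite big_ord0; rewrite Rintegral_cst// mul0r.
  rewrite big_ord_recr /= IH -Rintegral_cos_affine//.
  rewrite -RintegralZl//; last exact: cint.
  rewrite -RintegralD//; [|exact: cint|].
    by apply: eq_Rintegral => s _; rewrite /P big_ord_recr.
  apply: (cint (fun s => d ^+ n * cos (A n + B n * s))) => s.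
  by apply: cvgM; [exact: cvg_cst|exact: ccos].
rewrite -RintegralB//; [|exact: cint|exact: cint].
have cD : continuous (fun s : R => cos_series d (fun k => A k + B k * s) - P n s).
  by move=> s; apply: cvgB; [exact: cS|exact: cP].
apply: le_trans (le_normr_Rintegral _ _) _ => //; first exact: cint.
apply: (@le_trans _ _ (\int[mu]_(s in `[0, t]) (d ^+ n / (1 - d)))).
  apply: le_Rintegral => //.
  - by apply: (cint (fun s => `|_|)) => s; apply: cvg_norm; exact: cD.
  - by apply: (cint (fun=> _)) => s; exact: cvg_cst.
  - by move=> s _; exact: cos_series_tail.
rewrite Rintegral_cst// mulrC /= lebesgue_measure_itv /= lte_fin t0 /=.
by rewrite subr0.
Qed.

End CosSeries.

(** * Phases modulo [2 pi] and sine increments *)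

Lemma eq_cos_series {R : realType} (d : R) (theta theta' : nat -> R) :
  (forall k, cos (theta k) = cos (theta' k)) ->
  cos_series d theta = cos_series d theta'.
Proof.
move=> h; rewrite /cos_series; suff -> : cos_term d theta = cos_term d theta' by [].
by apply/funext => k; rewrite /cos_term h.
Qed.

Lemma periodic_intr {R : realType} (g : R -> R) (T : R) : periodic g T ->
  forall (n : int) x, g (x + T * n%:~R) = g x.
Proof.
move=> gT [n|n] x; first by rewrite -pmulrn mulr_natr periodicn.
by rewrite NegzE intrN mulrN -pmulrn mulr_natr -(periodicn gT n.+1) subrK.
Qed.

(** The quotient is the mean of cosine over an interval of length [2 pi tau] starting at [A]. It
    equals [- 2 sin A / pi] for [tau = 1/2] and [2 (cos A - sin A) / pi] for [tau = 1/4], and these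
    cannot both be small. *)
Lemma sin_increment_lower {R : realType} (A : R) : exists tau : R,
  [/\ 4^-1 <= tau, tau <= 2^-1 &
     8^-1 <= `|(sin (A + pi *+ 2 * tau) - sin A) / (pi *+ 2 * tau)|].
Proof.
have pi0 := @pi_gt0 R; have pi4 : (pi : R) < 4 by have := @pihalf_lt2 R; lra.
have piV : 4^-1 < (pi : R)^-1 by rewrite ltf_pV2// posrE.
have sc := cos2Dsin2 A.
have [S|S] := leP 4^-1 `|sin A|.
- exists 2^-1; split; [lra|lra|].
  have -> : pi *+ 2 * 2^-1 = pi :> R by lra.
  rewrite sinDpi -opprD mulNr normrN normrM [`|_^-1|]gtr0_norm ?invr_gt0//.
  have -> : sin A + sin A = 2 * sin A by ring.
  rewrite normrM [`|2|]gtr0_norm//; nra.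
(* Here [|sin A| < 1/4] forces [|cos A| >= 3/4], so the two differ by at least [1/2]. *)
- exists 4^-1; split; [lra|lra|].
  have -> : pi *+ 2 * 4^-1 = pi / 2 :> R by lra.
  rewrite sinDpihalf normrM [`|_^-1|]gtr0_norm ?invr_gt0 ?divr_gt0// invf_div.
  have C : 2^-1 <= `|cos A - sin A|.
    have CS := lerB_dist (cos A) (sin A).
    have : 3/4 <= `|cos A|.
      have c2 : `|cos A| ^+ 2 = cos A ^+ 2 by rewrite real_normK ?num_real.
      have s2 : `|sin A| ^+ 2 = sin A ^+ 2 by rewrite real_normK ?num_real.
      have := normr_ge0 (sin A); have := normr_ge0 (cos A); nra.
    lra.
  nra.
Qed.

(** * The function on the torus: periodicity, restriction to orbits, zero mean *)

Definition torus_phase {R : realType} (p q : int) (z : R * R) : R :=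
  pi *+ 2 * (q%:~R * z.2 - p%:~R * z.1).

Definition wave_series {R : realType} (d : R) (p q : nat -> int) (z : R * R) : R :=
  cos_series d (fun k => torus_phase (p k) (q k) z).

Section WaveSeries.
Variables (R : realType) (d : R) (p q : nat -> int).
Hypothesis d01 : 0 < d < 1.

Local Notation f := (wave_series d p q).

(** As [p k] and [q k] are integers, each phase moves by a multiple of [2 pi]. This gives the
    periodicity of [f] and also absorbs the floors in [winding]. *)
Lemma wave_series_shift (x y : R) (m n : int) :
  f (x + m%:~R, y + n%:~R) = f (x, y).
Proof.
apply: eq_cos_series => k.
rewrite -[RHS](periodic_intr _ _ (@cosD2pi R) (q k * n - p k * m)).
by congr cos; rewrite /torus_phase /= intrD intrN !intrM; ring.
Qed.

Lemma torus_continuous_wave_series : torus_continuous f.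
Proof.
split; last first.
  split=> x y; first by have := wave_series_shift x y 1 0; rewrite addr0.
  by have := wave_series_shift x y 0 1; rewrite addr0.
apply: (continuous_cos_series _ _ d01) => k z; apply: cvgM; first exact: cvg_cst.
by apply: cvgB; apply: cvgM; [exact: cvg_cst|exact: cvg_snd|exact: cvg_cst|exact: cvg_fst].
Qed.

Lemma wave_series_winding (c s : R) (z : R * R) :
  f (winding c s z) = cos_series d (fun k => torus_phase (p k) (q k) z +
    pi *+ 2 * ((q k)%:~R * c - (p k)%:~R) * s).
Proof.
rewrite /winding /Defs.frac -!mulrNz wave_series_shift.
by apply: eq_cos_series => k; congr cos; rewrite /torus_phase /=; ring.
Qed.

(** Fubini needs measurability for the product sigma-algebra, obtained here from the partial sums by
    pointwise convergence. *)
Lemma measurable_wave_series :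
  measurable_fun [set: measurableTypeR R * measurableTypeR R] f.
Proof.
apply: (@measurable_fun_cvg _ _ R setT
  (fun m z => series (cos_term d (fun k => torus_phase (p k) (q k) z)) m)); last first.
  by move=> z _; exact: cvg_cos_series.
move=> m; apply: measurable_sum => k; apply: measurable_funM => //.
apply: (@measurableT_comp _ _ _ _ _ _ (@cos R)).
  by apply: continuous_measurable_fun; exact: continuous_cos.
apply: measurable_funM => //; by apply: measurable_funB; apply: measurable_funM.
Qed.

(** Over a unit interval in [y] each phase turns [q k] times, a nonzero integer, so each term
    integrates to 0. Only tails remain, and they are arbitrarily small. *)
Lemma wave_series_line_integral (x : R) : (forall k, q k != 0) ->
  \int[lebesgue_measure]_(y in `[0, 1]) f (x, y) = 0.
Proof.
move=> q0; set I := Rintegral _ _ _.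
suff : forall n, `|I| <= d ^+ n / (1 - d).
  move=> h; apply/normr0_eq0/eqP; rewrite eq_le normr_ge0 andbT.
  rewrite -(cvg_lim _ (cos_series_tail_cvg0 _ _ d01))//; apply: limr_ge; last exact: nearW.
  by apply/cvg_ex; eexists; exact: (cos_series_tail_cvg0 _ _ d01).
move=> n.
pose A k : R := - (pi *+ 2 * ((p k)%:~R * x)); pose B k : R := pi *+ 2 * (q k)%:~R.
have B0 k : B k != 0.
  by rewrite mulf_neq0 ?intr_eq0// mulrn_eq0/= gt_eqF// pi_gt0.
have := Rintegral_cos_series _ _ d01 A B n _ B0 ltr01.
rewrite big1 ?subr0 ?mul1r; last first.
  by move=> k _; rewrite mulr1 (periodic_intr _ _ (@sinD2pi R)) subrr mul0r mulr0.
congr (`|_| <= _); apply: eq_Rintegral => y _; rewrite /wave_series.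
by congr (cos_series d _); apply/funext => k; rewrite /torus_phase /A /B/=; ring.
Qed.

Lemma integral_wave_series : (forall k, q k != 0) ->
  (\int[leb2]_(z in torus) (f z)%:E = 0)%E.
Proof.
move=> q0.
have mT : measurable (torus : set (measurableTypeR R * measurableTypeR R)).
  by rewrite /torus; apply: measurableX.
have leb2_torus : leb2 (torus : set (R * R)) = 1%E.
  transitivity (@lebesgue_measure R `[0%R, 1%R[ * @lebesgue_measure R `[0%R, 1%R[)%E.
    exact: product_measure1E.
  by rewrite lebesgue_measure_itv/= lte_fin ltr01 oppr0 adde0 mule1.
have fint : leb2.-integrable torus (EFin \o f).
  apply: measurable_bounded_integrable => //.
  - by have := ltry (1 : R); rewrite -leb2_torus.
  - by apply: measurable_funTS; exact: measurable_wave_series.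
  - exists (1 - d)^-1; split; first exact: num_real.
    move=> M hM z _ /=; apply: le_trans (ltW hM); exact: cos_series_bound.
(* Extension by zero outside the torus, then Fubini with [y] as the inner variable. *)
rewrite integral_mkcond -integral12_prod_meas1; last first.
  exact: (iffLR (integrable_mkcond _ mT) fint).
rewrite integral0_eq// => x _; rewrite /fubini_F.
have [x01|x01] := pselect (`[0, 1[%classic x); last first.
  by rewrite integral0_eq// => y _; rewrite patchE memNset// => -[/x01].
transitivity (\int[lebesgue_measure]_(y in `[0%R, 1%R[) (f (x, y))%:E)%E.
  rewrite [RHS]integral_mkcond; apply: eq_integral => y _; rewrite !patchE.
  congr (if _ then _ else _); apply/idP/idP; rewrite !inE /torus /=; first by case.
  by split.
(* The missing endpoint is negligible; this leads to the closed interval of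
   [wave_series_line_integral]. *)
rewrite integral_itv_bndo_bndc; last first.
  apply/measurable_EFinP; apply: measurable_funTS.
  by apply: (measurableT_comp measurable_wave_series); exact: measurable_pair1.
have cf : continuous (fun y => f (x, y)).
  apply: (continuous_cos_series _ _ d01 R
    (fun k y => torus_phase (p k) (q k) (x, y))) => k y; rewrite /torus_phase /=.
  apply: cvgM; first exact: cvg_cst.
  by apply: cvgB; [apply: cvgM; [exact: cvg_cst|exact: cvg_id]|exact: cvg_cst].
rewrite -[LHS]fineK; first by rewrite [fine _]wave_series_line_integral.
apply: integrable_fin_num => //; apply: continuous_compact_integrable.
  exact: segment_compact.
exact: continuous_subspaceT.
Qed.

End WaveSeries.

(** * Lower bound for the Birkhoff averages at a suitable time *)

(* The main term is at least [d ^+ n / 8]; the terms [k < n] cost at most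
   [d ^+ n / 32] and the terms [k > n] at most [d ^+ n / 31]. *)
Lemma birkhoff_wave_series_lower {R : realType} (c : R) (p q : nat -> int)
    (w := fun k => (q k)%:~R * c - (p k)%:~R) (d := 32^-1 : R) (n : nat) (z : R * R) :
  (forall k, 0 < w k) ->
  (forall k, (k < n)%N -> w n <= w k * (d ^+ n / 256)) ->
  exists2 t : R, (4 * w n)^-1 <= t &
    d ^+ n / 32 <= `|birkhoff c (wave_series d p q) t z|.
Proof.
move=> w0 wn; have d01 : 0 < d < 1 by rewrite /d; lra.
have dn0 k : 0 < d ^+ k by rewrite exprn_gt0 //; case/andP: d01.
pose A k := torus_phase (p k) (q k) z; pose B k := pi *+ 2 * w k.
have pi2 := @pi_ge2 R.
have B0 k : 0 < B k by rewrite mulr_gt0 // mulrn_wgt0 // pi_gt0.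
have [tau [tau4 tau2 main]] := sin_increment_lower (A n).
have wn0 := w0 n.
(* At this time the [n]-th phase has advanced by exactly [2 pi tau]. *)
exists (tau / w n).
  by rewrite invfM ler_wpM2r // invr_ge0 ltW.
set t := tau / w n.
have tau0 : 0 < tau by lra.
have t0 : 0 < t by rewrite divr_gt0.
have BA : B n * t = pi *+ 2 * tau by rewrite /B /t; field; rewrite gt_eqF.
(* Keeping [n.+1] terms makes term [n] the last of the sum, and the tail [d ^+ n.+1 / (1 - d)]
   equals [d ^+ n / 31]. *)
have := Rintegral_cos_series _ _ d01 A B n.+1 _ (fun k => lt0r_neq0 (B0 k)) t0.
rewrite big_ord_recr /= BA.
have -> : birkhoff c (wave_series d p q) t z =
    t^-1 * \int[lebesgue_measure]_(s in `[0, t]) cos_series d (fun k => A k + B k * s).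
  congr (_ * _); apply: eq_Rintegral => s _; exact: wave_series_winding.
set I := Rintegral _ _ _; set Sig := \sum_(k < n) _; set M := (sin _ - sin _) in main *.
move=> hI.
(* A sine increment is at most 2 and [B k >= 2 * w k], so the [k]-th quotient is at most
   [1 / w k <= d ^+ n / (256 * w n)]; the geometric weights sum to at most 2. *)
have hSig : `|Sig| <= d ^+ n / (128 * w n).
  apply: le_trans (ler_norm_sum _ _ _) _.
  apply: (@le_trans _ _ (\sum_(k < n) d ^+ k * (d ^+ n / (256 * w n)))).
    apply: ler_sum => k _; rewrite normrM gtr0_norm// ler_pM2l//.
    rewrite normrM [`|_^-1|]gtr0_norm ?invr_gt0//.
    have s2 : `|sin (A k + B k * t) - sin (A k)| <= 2.
      by apply: le_trans (ler_normB _ _) _; apply: lerD; exact: sin_max.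
    rewrite ler_pdivrMr//; apply: le_trans s2 _.
    have wk := wn k (ltn_ord k); have wk0 := w0 k.
    have Bw : 2 * w k <= B k by rewrite /B ler_pM2r //; lra.
    rewrite mulrAC ler_pdivlMr ?mulr_gt0//; have := dn0 n; nra.
  rewrite -mulr_suml.
  have -> : \sum_(i < n) d ^+ i = (1 - d ^+ n) / (1 - d).
    have := @geometric_seriesE R 1 d; rewrite lt_eqF; last by case/andP: d01.
    move=> /(_ isT) /(congr1 (fun u => u n)); rewrite /series /= big_mkord mul1r => <-.
    by apply: eq_bigr => i _; rewrite /geometric /= mul1r.
  have -> : d ^+ n / (128 * w n) = 2 * (d ^+ n / (256 * w n)).
    by field; rewrite gt_eqF.
  apply: ler_wpM2r; first by rewrite divr_ge0 ?mulr_ge0 ?ltW.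
  have := dn0 n; rewrite ler_pdivrMr /d; lra.
have hmain : d ^+ n / 8 <= `|t^-1 * (d ^+ n * (M / B n))|.
  have -> : t^-1 * (d ^+ n * (M / B n)) = d ^+ n * (M / (pi *+ 2 * tau)).
    rewrite -BA; field; rewrite !gt_eqF//.
  by rewrite normrM gtr0_norm// ler_pM2l.
(* Dividing by [t >= 1 / (4 * w n)] turns the 128 into 32. *)
have hS : `|t^-1 * Sig| <= d ^+ n / 32.
  rewrite normrM gtr0_norm ?invr_gt0// mulrC ler_pdivrMr//.
  apply: le_trans hSig _.
  have -> : d ^+ n / (128 * w n) = d ^+ n / 32 * (4^-1 / w n).
    by field; rewrite gt_eqF.
  by rewrite ler_pM2l ?divr_gt0// /t ler_pM2r ?invr_gt0.
have hI' : `|t^-1 * I - (t^-1 * Sig + t^-1 * (d ^+ n * (M / B n)))| <= d ^+ n / 31.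
  rewrite -mulrDr -mulrBr normrM gtr0_norm ?invr_gt0// mulrC ler_pdivrMr//.
  have d31 : d / (1 - d) = 31^-1 by rewrite /d; field.
  by apply: le_trans hI _; rewrite exprSr -mulrA d31 mulrC.
move: hmain hS hI'; set X := t^-1 * (_ * _); set Y := t^-1 * Sig; set Z := t^-1 * I.
move=> hX hY hZ; have := dn0 n.
have : `|X| <= `|Z - (Y + X)| + `|Z| + `|Y|.
  have {1}-> : X = - (Z - (Y + X)) + Z - Y by ring.
  apply: le_trans (ler_normB _ _) _; rewrite lerD2r.
  by apply: le_trans (ler_normD _ _) _; rewrite normrN.
(* Numerically, [1/8 - 1/32 - 1/31 >= 1/32]. *)
lra.
Qed.

(** * Choice of the frequencies *)

(** Each index is chosen from its predecessor alone. Since [eta <= 1], [w] decreases along [g], so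
    comparison with the predecessor yields comparison with all earlier indices. *)
Lemma fast_decreasing_choice {R : realType} (P : nat -> Prop) (w eps eta : nat -> R) :
  (forall e, 0 < e -> exists n, P n /\ 0 < w n < e) ->
  (forall k, 0 < eps k) -> (forall k, 0 < eta k <= 1) ->
  exists g : nat -> nat, forall k,
    [/\ P (g k), 0 < w (g k), w (g k) < eps k &
        forall j, (j < k)%N -> w (g k) <= w (g j) * eta k].
Proof.
move=> small eps0 eta01.
(* A selector defined on all reals; for [e <= 0] the index 0 is a mere default. *)
have [N hN] : {N : R -> nat & forall e : R, 0 < e -> P (N e) /\ 0 < w (N e) < e}.
  apply: (@choice _ _ (fun (e : R) (n : nat) => 0 < e -> P n /\ 0 < w n < e)) => e.
  by have [/small[n ?]|] := pselect (0 < e); [exists n|exists 0%N].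
pose g := fix g k := match k with
  | 0 => N (eps 0)
  | k'.+1 => N (Num.min (eps k'.+1) (w (g k') * eta k'.+1))
  end.
have gP k : P (g k) /\ 0 < w (g k) < eps k.
  elim: k => [|k [_ /andP[wk _]]]; first exact: hN.
  have /andP[eta0 _] := eta01 k.+1.
  have [|? /andP[w0]] := hN (Num.min (eps k.+1) (w (g k) * eta k.+1)).
    by rewrite lt_min eps0 mulr_gt0.
  by rewrite lt_min => /andP[we _]; split=> //; apply/andP.
have wg0 k : 0 < w (g k) by case: (gP k) => _ /andP[].
have gS k : w (g k.+1) <= w (g k) * eta k.+1.
  have /andP[eta0 _] := eta01 k.+1.
  have [|_ /andP[_]] := hN (Num.min (eps k.+1) (w (g k) * eta k.+1)).
    by rewrite lt_min eps0 mulr_gt0.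
  by rewrite lt_min => /andP[_ /ltW].
have gle j k : (j <= k)%N -> w (g k) <= w (g j).
  move=> jk; rewrite -(subnKC jk); elim: (k - j)%N => [|i IH]; first by rewrite addn0.
  rewrite addnS; apply: le_trans (gS _) _; apply: le_trans IH.
  by rewrite ler_piMr ?(ltW (wg0 _))//; case/andP: (eta01 (j + i).+1).
exists g => k; have [Pk /andP[w0 wk]] := gP k; split=> // j.
case: k {Pk} w0 wk => // k _ _ jk; apply: le_trans (gS k) _.
by rewrite ler_pM2r ?gle//; case/andP: (eta01 k.+1).
Qed.

(** * Adapting the subsequence to [phi] *)

Theorem theorem4 (R : realType) (c : R)
  (c_irr : forall (p q : int), q != 0 -> c != p%:~R / q%:~R)
  (p q : nat -> int)
  (q_oo : (fun n => (q n)%:~R : R) @ \oo --> +oo)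
  (pos : forall n, 0 < c - (p n)%:~R / (q n)%:~R)
  (approx : (fun n => (q n)%:~R ^+ 2 * (c - (p n)%:~R / (q n)%:~R)) @ \oo --> (0 : R))
  (phi : R -> R)
  (phi_pos : forall t, 0 < t -> 0 < phi t)
  (phi_0 : phi t @[t --> +oo] --> (0 : R)) :
  exists f : R * R -> R,
    torus_continuous f /\
    (\int[leb2]_(z in torus) (f z)%:E = 0)%E /\
    {ae leb2, forall z, torus z ->
       forall (K : R) (t0 : R), exists t, t0 < t /\ 0 < t /\
         K < `| birkhoff c f t z | / phi t}.
Proof.
pose w n := (q n)%:~R * c - (p n)%:~R.
(* For large [n], [q n >= 1], so [w n = q n (c - p n / q n)] is positive and at most
   [q n ^ 2 (c - p n / q n)], which tends to 0. *)
have small e : 0 < e -> exists n, q n != 0 /\ 0 < w n < e.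
  move=> e0.
  have /cvgryPge/(_ 1) q1 := q_oo.
  have /cvgrPdist_lt/(_ _ e0) qw := approx.
  have [n [qn wn]] : exists n, 1 <= (q n)%:~R :> R /\
      `|0 - (q n)%:~R ^+ 2 * (c - (p n)%:~R / (q n)%:~R)| < e.
    near \oo => n; exists n; split; near: n; [exact: q1|exact: qw].
  have q0 : 0 < (q n)%:~R :> R by lra.
  exists n; split; first by move: q0; rewrite ltr0z => /gt_eqF ->.
  have wE : w n = (q n)%:~R * (c - (p n)%:~R / (q n)%:~R).
    by rewrite /w; field; rewrite gt_eqF.
  have w0 : 0 < w n by rewrite wE mulr_gt0.
  rewrite w0 /=; move: wn; rewrite sub0r normrN expr2 -mulrA -wE gtr0_norm ?mulr_gt0//.
  by apply: le_lt_trans; rewrite ler_peMl// ltW.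
pose d : R := 32^-1.
have d01 : 0 < d < 1 by rewrite /d; lra.
have d0 k : 0 < d ^+ k by rewrite exprn_gt0 //; case/andP: d01.
(* Beyond [T k], [phi] is below the guaranteed size [d ^+ k / 32] of the average by a factor
   [k + 1]. *)
have [T hT] : {T : nat -> R & forall k t, T k < t ->
    phi t < d ^+ k / 32 / k.+1%:R}.
  apply: (@choice _ _ (fun (k : nat) (T : R) => forall t, T < t -> phi t < d ^+ k / 32 / k.+1%:R)) => k.
  have e0 : 0 < d ^+ k / 32 / k.+1%:R by rewrite !divr_gt0.
  have /cvgrPdist_lt/(_ _ e0)[M [_ hM]] := phi_0.
  exists M => t /hM; rewrite /= sub0r normrN; exact: le_lt_trans (ler_norm _).
(* With [w (g k) < eps k], the time [1 / (4 * w (g k))] exceeds both [T k] and [k + 1]. *)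
pose eps k : R := (4 * (`|T k| + k.+1%:R))^-1.
have S0 k : 0 < `|T k| + k.+1%:R by rewrite ltr_wpDl.
have eps0 k : 0 < eps k by rewrite invr_gt0 mulr_gt0.
have eta01 k : 0 < d ^+ k / 256 <= 1.
  rewrite divr_gt0 //= ler_pdivrMr// mul1r.
  apply: (@le_trans _ _ 1); last lra.
  by rewrite exprn_ile1 //; case/andP: d01 => /ltW ? /ltW ?.
have [g gP] := fast_decreasing_choice _ _ _ _ small eps0 eta01.
have wg0 k : 0 < w (g k) by case: (gP k).
have qg0 k : (q \o g) k != 0 by case: (gP k).
exists (wave_series d (p \o g) (q \o g)); split; first exact: torus_continuous_wave_series.
split; first exact: integral_wave_series.
apply: aeW => z _ K t0.
(* For this [k] the time found exceeds [k + 1 > t0] and the ratio exceeds [k + 1 > K]. *)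
pose k := (Num.trunc (`|K| + `|t0|)).+1.
have kK : `|K| + `|t0| < k%:R by exact: truncnS_gt.
have [_ _ wk gk] := gP k.
have [t wt bt] := birkhoff_wave_series_lower c (p \o g) (q \o g) k z wg0 gk.
have tT : `|T k| + k.+1%:R < t.
  apply: (@lt_le_trans _ _ (4 * w (g k))^-1); last exact: wt.
  move: wk; rewrite /eps -[X in _ < X]mul1r ltr_pdivlMr ?mulr_gt0// => wk.
  by rewrite -[ltRHS]mul1r ltr_pdivlMr ?mulr_gt0//; lra.
have k0 : 0 <= `|K| := normr_ge0 _; have l0 : 0 <= `|t0| := normr_ge0 _.
have m0 : 0 <= `|T k| := normr_ge0 _.
have kS : k.+1%:R = k%:R + 1 :> R by rewrite -natr1.
have Kle := ler_norm K; have tle := ler_norm t0; have Tle := ler_norm (T k).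
exists t; split; first lra.
have tp : 0 < t by lra.
split=> //; rewrite ltr_pdivlMr ?phi_pos//; apply: lt_le_trans bt.
have : phi t < d ^+ k / 32 / k.+1%:R by apply: hT; lra.
rewrite ltr_pdivlMr// mulrC; apply: le_lt_trans.
by rewrite ler_pM2r ?phi_pos//; lra.
Unshelve. all: by end_near. Qed.
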